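(* Let $n\geq 2$ be an integer and let $(m,r)$ be a pair of natural numbers admissible for $n$, i.e., either $(m,r)=(0,0)$, or $m\geq 1$ and $r>n$. Then there is a theory $T$ with ${\rm aar}(T)=n$ and ${\rm deg}_{\rm aar}(T)=(m,r)$.
   Context: For $n\geq 1$, a formula $\varphi(\overline{x})$ of a first-order theory $T$ is called $n$-ary (an $n$-formula) if it is $T$-equivalent to a Boolean combination of $T$-formulas each of which has $n$ free variables. $T$ is unary if every $T$-formula is $T$-equivalent to a Boolean combination of $T$-formulas with one free variable and formulas $x\approx y$; for $n\geq 2$, $T$ is $n$-ary if every $T$-formula is $n$-ary. ${\rm ar}(T)=n$ if $T$ is $n$-ary and not $(n-1)$-ary, and ${\rm ar}(T)=\infty$ if $T$ has no arity. $T$ is almost $n$-ary if there are finitely many formulas $\varphi_1(\overline{x}),\ldots,\varphi_m(\overline{x})$ (said to witness that $T$ is almost $n$-ary) such that every $T$-formula is $T$-equivalent to a Boolean combination of $n$-formulas and of formulas obtained from $\varphi_1(\overline{x}),\ldots,\varphi_m(\overline{x})$ by substitutions of free variables. ${\rm aar}(T)$ is the least $n$ such that $T$ is almost $n$-ary. For a theory $T$ with ${\rm aar}(T)=n$, the aar-degree ${\rm deg}_{\rm aar}(T)$ is the pair $(m,l(\overline{x}))$, where $\{\varphi_1(\overline{x}),\ldots,\varphi_m(\overline{x})\}$ is a minimal witnessing set for the almost $n$-arity of $T$ (so $m$ is the minimal number of witnessing formulas and $l(\overline{x})$ the corresponding minimal length of their tuple of free variables); for such a minimal set either $m=0$ or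 $l(\overline{x})>n$, and when $m=0$ (i.e., ${\rm ar}(T)={\rm aar}(T)=n$) one puts $l(\overline{x})=0$, so the degree is $(0,0)$.
   Formalization: ''Substitutions of free variables'' in the witnessing formulas are taken to put pairwise distinct variables for distinct free variables; if variables could be identified, any two witnesses would merge into one and no theory would have degree (m,r) with m at least 2. *)

(* Defs.v *)
From mathcomp Require Import all_boot.

Set Implicit Arguments.
Unset Strict Implicit.
Unset Printing Implicit Defensive.

(* First-order logic with equality; variables are de Bruijn indices, so that in
   [Ex phi] the index 0 is bound and x.+1 denotes the outer variable x. *)

Record signature : Type := Signature {
  fsym : Type;
  far : fsym -> nat;
  rsym : Type;
  rar : rsym -> nat
}.

Inductive term (L : signature) : Type :=
  | Var of nat
  | App (f : fsym L) of ('I_(far f) -> term L).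

Inductive formula (L : signature) : Type :=
  | Eq of term L & term L
  | Rel (R : rsym L) of ('I_(rar R) -> term L)
  | Not of formula L
  | And of formula L & formula L
  | Ex of formula L.

Arguments Var {L} _.
Arguments App {L} f _.
Arguments Eq {L} _ _.
Arguments Rel {L} R _.
Arguments Not {L} _.
Arguments And {L} _ _.
Arguments Ex {L} _.

Fixpoint tfv (L : signature) (t : term L) : seq nat :=
  match t with
  | Var x => [:: x]
  | App f a => flatten [seq tfv (a i) | i <- enum 'I_(far f)]
  end.

(* The list of free variables of a formula, possibly with repetitions. *)
Fixpoint fv (L : signature) (phi : formula L) : seq nat :=
  match phi with
  | Eq s t => tfv s ++ tfv t
  | Rel R a => flatten [seq tfv (a i) | i <- enum 'I_(rar R)]
  | Not psi => fv psi
  | And psi chi => fv psi ++ fv chi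
  | Ex psi => [seq x.-1 | x <- fv psi & 0 < x]
  end.

Fixpoint tren (L : signature) (rho : nat -> nat) (t : term L) : term L :=
  match t with
  | Var x => Var (rho x)
  | App f a => App f (fun i => tren rho (a i))
  end.

Definition upren (rho : nat -> nat) (x : nat) : nat :=
  if x is y.+1 then (rho y).+1 else 0.

(* Capture-avoiding substitution of the variable [rho x] for each free [x]. *)
Fixpoint ren (L : signature) (rho : nat -> nat) (phi : formula L) : formula L :=
  match phi with
  | Eq s t => Eq (tren rho s) (tren rho t)
  | Rel R a => Rel R (fun i => tren rho (a i))
  | Not psi => Not (ren rho psi)
  | And psi chi => And (ren rho psi) (ren rho chi)
  | Ex psi => Ex (ren (upren rho) psi)
  end.

Record structure (L : signature) : Type := Structure {
  dom : Type;
  dom_inhabited : inhabited dom;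
  fint : forall f : fsym L, ('I_(far f) -> dom) -> dom;
  rint : forall R : rsym L, ('I_(rar R) -> dom) -> Prop
}.

Fixpoint eval (L : signature) (M : structure L) (e : nat -> dom M)
    (t : term L) : dom M :=
  match t with
  | Var x => e x
  | App f a => fint (fun i => eval e (a i))
  end.

Definition push (D : Type) (d : D) (e : nat -> D) (x : nat) : D :=
  if x is y.+1 then e y else d.

Fixpoint sat (L : signature) (M : structure L) (e : nat -> dom M)
    (phi : formula L) : Prop :=
  match phi with
  | Eq s t => eval e s = eval e t
  | Rel R a => rint (fun i => eval e (a i))
  | Not psi => ~ sat e psi
  | And psi chi => sat e psi /\ sat e chi
  | Ex psi => exists d : dom M, sat (push d e) psi
  end.

Record theory (L : signature) : Type := Theory {
  axiom : formula L -> Prop;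
  axiom_closed : forall phi, axiom phi -> fv phi = [::]
}.

Definition model (L : signature) (T : theory L) (M : structure L) : Prop :=
  forall phi, axiom T phi -> forall e : nat -> dom M, sat e phi.

Definition T_equiv (L : signature) (T : theory L) (phi psi : formula L) : Prop :=
  forall M : structure L, model T M ->
  forall e : nat -> dom M, sat e phi <-> sat e psi.

Inductive bool_comb (L : signature) (P : formula L -> Prop) :
    formula L -> Prop :=
  | bc_base phi : P phi -> bool_comb P phi
  | bc_not phi : bool_comb P phi -> bool_comb P (Not phi)
  | bc_and phi psi :
      bool_comb P phi -> bool_comb P psi -> bool_comb P (And phi psi).

(* n-formulas.  "n free variables" means free variables among n variables:
   dummy variables can always be added by conjunction with x = x. *)
Definition nary (L : signature) (T : theory L) (n : nat) (phi : formula L) :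
    Prop :=
  exists psi : formula L,
    bool_comb (fun chi => size (undup (fv chi)) <= n) psi /\ T_equiv T phi psi.

(* Substitutions put pairwise distinct variables for the distinct free
   variables of a formula.  If variables could be identified, then for n >= 2
   any two witnesses f(x), g(x) could be merged into the single witness
   h(x,y,z) := (y = z /\ f(x)) \/ (y <> z /\ g(x)): f(x) is h(x,x_1,x_1), and
   g(x) is h(x,x_i,x_j) whenever x_i <> x_j, and unary when all x_i are equal.
   The least number of witnesses would then never exceed 1. *)
Definition instance (L : signature) (phi chi : formula L) : Prop :=
  exists rho : nat -> nat, {in fv phi &, injective rho} /\ chi = ren rho phi.

Definition witnesses (L : signature) (T : theory L) (n m : nat)
    (phi : 'I_m -> formula L) : Prop :=
  forall theta : formula L, exists psi : formula L,
    bool_comb (fun chi => nary T n chi \/ exists i, instance (phi i) chi) psi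
    /\ T_equiv T theta psi.

Definition almost_ary (L : signature) (T : theory L) (n : nat) : Prop :=
  exists (m : nat) (phi : 'I_m -> formula L), witnesses T n phi.

(* aar(T) = n *)
Definition is_aar (L : signature) (T : theory L) (n : nat) : Prop :=
  [/\ 1 <= n, almost_ary T n
    & forall k, 1 <= k -> almost_ary T k -> n <= k].

(* Almost n-arity is witnessed by phi_1(x), ..., phi_m(x), where x is a tuple
   of l pairwise distinct variables. *)
Definition witnessed_by (L : signature) (T : theory L) (n m l : nat) : Prop :=
  exists (x : l.-tuple nat) (phi : 'I_m -> formula L),
    [/\ uniq x, forall i, {subset fv (phi i) <= x} & witnesses T n phi].

(* deg_aar(T) = (m, l).  For m = 0 the condition on x in [witnessed_by] is
   vacuous, so the least l is 0 as required. *)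
Definition is_deg_aar (L : signature) (T : theory L) (m l : nat) : Prop :=
  exists n : nat,
    [/\ is_aar T n,
        witnessed_by T n m l,
        forall m' l', witnessed_by T n m' l' -> m <= m'
      & forall l', witnessed_by T n m l' -> l <= l'].

Definition admissible (n m r : nat) : Prop :=
  (m = 0 /\ r = 0) \/ (1 <= m /\ n < r).

(* Main.v *)
From Stdlib Require Import Classical ClassicalEpsilon FunctionalExtensionality.
Require Import Defs.
From mathcomp Require Import all_boot.

(** The language has infinitely many n-ary relations and m further r-ary ones,
    all of them holding only at injective tuples.  In structures generic for
    this language a back-and-forth argument eliminates quantifiers, so that the
    r-ary relations witness almost n-arity.

    For the lower bounds, the generic structures may contain an infinite set of
    indiscernible points on which each relation s is either full or empty, as
    prescribed by an arbitrary colour c.  There the truth value of a formula is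
    unaffected by injective renamings of its variables, and it depends only on
    the colours of the relations whose arity is at most the number of free
    variables.  Hence m' witnesses take at most 2^m' vectors of values, while p
    relations of arity > k have 2^p colours, so almost k-arity needs m' >= p.
    With k < n and p = m'+1 this rules out almost k-arity; with k = n and the
    r-ary relations it gives m' >= m.  Witnesses in fewer than r variables do
    not see the r-ary relations at all. *)

Set Implicit Arguments.
Unset Strict Implicit.
Unset Printing Implicit Defensive.

(** * Renaming of variables *)

Lemma push_upren (D : Type) (d : D) (e : nat -> D) (rho : nat -> nat) :
  push d e \o upren rho = push d (e \o rho).
Proof. by apply: functional_extensionality; case. Qed.

Lemma eval_tren (L : signature) (M : structure L) (e : nat -> dom M) rho t :
  eval e (tren rho t) = eval (e \o rho) t.
Proof.
elim: t => [//|f a IH] /=; congr (fint _).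
by apply: functional_extensionality => i; apply: IH.
Qed.

Lemma sat_ren (L : signature) (M : structure L) phi :
  forall (e : nat -> dom M) rho, sat e (ren rho phi) <-> sat (e \o rho) phi.
Proof.
elim: phi => [s t|R a|phi IH|phi IHphi psi IHpsi|phi IH] e rho /=.
- by rewrite !eval_tren.
- suff -> : (fun i => eval e (tren rho (a i))) = fun i => eval (e \o rho) (a i).
    by [].
  by apply: functional_extensionality => i; apply: eval_tren.
- by rewrite IH.
- by rewrite IHphi IHpsi.
- by split=> -[d]; [rewrite IH push_upren | rewrite -push_upren -IH]; exists d.
Qed.

(** * Theories of classes of structures *)

Definition theory_axiom (L : signature) (K : structure L -> Prop)
    (phi : formula L) : Prop :=
  fv phi = [::] /\ forall M, K M -> forall e : nat -> dom M, sat e phi.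

Definition theory_of (L : signature) (K : structure L -> Prop) : theory L :=
  @Theory L (theory_axiom K) (fun phi h => proj1 h).

Lemma model_theory_of (L : signature) (K : structure L -> Prop) M :
  K M -> model (theory_of K) M.
Proof. by move=> KM phi [_]; apply. Qed.

Lemma fv_iter_Ex (L : signature) N (phi : formula L) :
  {in fv phi, forall x, x < N} -> fv (iter N Ex phi) = [::].
Proof.
elim: N phi => [|N IH] phi ltN.
  by case E: (fv phi) ltN => [//|x s] /(_ x); rewrite mem_head => /(_ isT).
rewrite iterSr; apply: IH => x /= /mapP[[|y]]; rewrite mem_filter //= => yphi ->.
exact: ltN yphi.
Qed.

Lemma sat_iter_Ex (L : signature) (M : structure L) N :
  forall phi (e : nat -> dom M),
  sat e phi -> sat (fun x => e (x + N)) (iter N Ex phi).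
Proof.
elim: N => [|N IH] phi e ephi.
  suff -> : (fun x => e (x + 0)) = e by [].
  by apply: functional_extensionality => x; rewrite addn0.
have -> : (fun x => e (x + N.+1)) = fun x => (fun y => e y.+1) (x + N).
  by apply: functional_extensionality => x; rewrite addnS.
rewrite iterSr; apply: (IH (Ex phi) (fun y => e y.+1)); exists (e 0).
suff -> : push (e 0) (fun x => e x.+1) = e by [].
by apply: functional_extensionality; case.
Qed.

Lemma iter_Ex_sat (L : signature) (M : structure L) N :
  forall phi (e : nat -> dom M),
  sat e (iter N Ex phi) -> exists e' : nat -> dom M, sat e' phi.
Proof.
elim: N => [|N IH] phi e; first by exists e.
by rewrite iterSr => /IH[e' [d]]; exists (push d e').
Qed.

(** A counterexample in an arbitrary model satisfies the existential closure of [And phi (Not psi)],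
    whose negation is an axiom. So equivalences need only be checked on [K], although the theory may
    have other models. *)
Lemma T_impl_theory_of (L : signature) (K : structure L -> Prop) phi psi :
  (forall M, K M -> forall e : nat -> dom M, sat e phi -> sat e psi) ->
  forall M, model (theory_of K) M ->
  forall e : nat -> dom M, sat e phi -> sat e psi.
Proof.
move=> imp M modM e ephi; apply: NNPP => Nepsi.
(* [N] exceeds every free variable of [bad], so [N] quantifiers close it. *)
pose bad := And phi (Not psi); pose N := (\max_(x <- fv bad) x).+1.
suff ax : theory_axiom K (Not (iter N Ex bad)).
  exact: (modM _ ax _ (@sat_iter_Ex _ M N bad e (conj ephi Nepsi))).
split; last first.
  move=> M' KM' e' sat_bad.
  by have [e'' [? []]] := @iter_Ex_sat _ M' N bad e' sat_bad; apply: imp.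
suff : fv (iter N Ex bad) = [::] by [].
apply: fv_iter_Ex => x xbad; rewrite /N ltnS.
exact: (@leq_bigmax_seq _ _ predT id x xbad isT).
Qed.

Lemma T_equiv_theory_of (L : signature) (K : structure L -> Prop) phi psi :
  (forall M, K M -> forall e : nat -> dom M, sat e phi <-> sat e psi) ->
  T_equiv (theory_of K) phi psi.
Proof.
by move=> eqv M modM e; split; apply: T_impl_theory_of modM _ => M' KM' e';
  apply eqv.
Qed.

(** * Boolean combinations of finitely many atoms *)

Lemma bool_comb_mono (L : signature) (P Q : formula L -> Prop) phi :
  (forall chi, P chi -> Q chi) -> bool_comb P phi -> bool_comb Q phi.
Proof.
move=> PQ; elim=> {phi} [phi /PQ|phi _|phi psi _ bphi _]; first exact: bc_base.
  exact: bc_not.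
exact: bc_and.
Qed.

(** Induction on [s], splitting on the truth value of its first atom. For empty [s], [Q] is constant
    on [K], and [Eq (Var 0) (Var 0)] or its negation expresses it. *)
Lemma bool_comb_of_agreement (L : signature) (K : structure L -> Prop)
    (I : eqType) (atom : I -> formula L) (s : seq I) :
  forall Q : (forall M : structure L, (nat -> dom M) -> Prop),
  (forall M M' e e', K M -> K M' ->
     {in s, forall i, sat e (atom i) <-> sat e' (atom i)} ->
     Q M e -> Q M' e') ->
  exists2 psi,
    bool_comb (fun chi => chi = Eq (Var 0) (Var 0)
                          \/ exists i, chi = atom i) psi &
    forall M, K M -> forall e : nat -> dom M, Q M e <-> sat e psi.
Proof.
elim: s => [|i s IH] Q invQ.
  have bcT : bool_comb (fun chi => chi = Eq (Var 0) (Var 0)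
               \/ exists i, chi = atom i) (Eq (Var 0) (Var 0)).
    by apply: bc_base; left.
  have [[M [e [KM Qe]]]|noQ] := classic (exists M e, K M /\ Q M e).
    by exists (Eq (Var 0) (Var 0)) => // M' KM' e'; split=> // _;
      apply: invQ Qe.
  exists (Not (Eq (Var 0) (Var 0))); first exact: bc_not.
  by move=> M KM e; split=> [Qe|]; [case: noQ; exists M, e | case].
(* Closing [Q] under agreement on the shorter list, with the truth value of [atom i] fixed as [b],
   makes the induction hypothesis applicable. *)
pose Qi (b : Prop) (M : structure L) (e : nat -> dom M) := exists M' (e' : nat -> dom M'),
  [/\ K M', Q M' e', sat e' (atom i) <-> b
    & {in s, forall j, sat e' (atom j) <-> sat e (atom j)}].
have invQi b M M' (e : nat -> dom M) (e' : nat -> dom M') : K M -> K M' ->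
    {in s, forall i, sat e (atom i) <-> sat e' (atom i)} ->
    Qi b M e -> Qi b M' e'.
  move=> KM KM' ag [M0 [e0 [K0 Q0 bi ag0]]]; exists M0, e0; split=> // j js.
  by rewrite ag0 // ag.
have [psi1 bc1 E1] := IH _ (invQi True).
have [psi0 bc0 E0] := IH _ (invQi False).
exists (Not (And (Not (And (atom i) psi1)) (Not (And (Not (atom i)) psi0)))).
  have bci : bool_comb (fun chi => chi = Eq (Var 0) (Var 0)
               \/ exists i, chi = atom i) (atom i).
    by apply: bc_base; right; exists i.
  by apply/bc_not/bc_and; apply/bc_not/bc_and => //; apply: bc_not.
move=> M KM e /=; rewrite -E1 // -E0 //.
have QiP (b : Prop) : (sat e (atom i) <-> b) -> Qi b M e <-> Q M e.
  move=> eb; split=> [[M' [e' [KM' Qe' ib ag]]]|Qe]; last by exists M, e.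
  apply: invQ Qe' => // j; rewrite inE => /orP[/eqP ->|/ag //].
  by rewrite ib eb.
have [ei|Nei] := classic (sat e (atom i)).
  have := QiP True; tauto.
have := QiP False; tauto.
Qed.

(** * Generic structures and back-and-forth *)

Section Generic.

Variables (S : eqType) (ar : S -> nat).

Definition rel_sig : signature := @Signature void (of_void nat) S ar.

Definition tvar (t : term rel_sig) : nat :=
  match t with Var x => x | App f _ => of_void nat f end.

Lemma termE t : t = Var (tvar t).
Proof. by case: t => [//|[]]. Qed.

Lemma term_tupleE (k : nat) (a : 'I_k -> term rel_sig) :
  a = fun i => Var (tvar (a i)).
Proof. by apply: functional_extensionality => i; apply: termE. Qed.

Lemma mem_fv_Rel (s : S) (t : 'I_(ar s) -> nat) x :
  reflect (exists i, x = t i)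
    (x \in fv (@Rel rel_sig s (fun i => Var (t i)))).
Proof.
rewrite /=; apply: (iffP flattenP) => [[_ /mapP[i _ ->]]|[i ->]].
  by rewrite inE => /eqP ->; exists i.
by exists [:: t i]; rewrite ?inE //; apply: map_f; rewrite mem_enum.
Qed.

Fixpoint syms (phi : formula rel_sig) : seq S :=
  match phi with
  | Eq _ _ => [::]
  | Rel s _ => [:: s]
  | Not psi => syms psi
  | And psi chi => syms psi ++ syms chi
  | Ex psi => syms psi
  end.

(* [Leaf k] are the indiscernible points.  [b = Node a W] is a fresh point over
   the family [a]: its relations with [a] are those listed by [W], a tuple of
   indices being read in the environment [push b a], so that 0 denotes [b]. *)
Inductive tree : Type :=
  | Leaf of nat
  | Node (a : nat -> tree) (W : forall s, ('I_(ar s) -> nat) -> Prop).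

Definition child (x b : tree) : Prop :=
  if b is Node a _ then exists k, x = a k else False.

Lemma child_wf : well_founded child.
Proof.
elim=> [k|a IH W]; apply: Acc_intro => x; first by case.
case=> k ->; exact: IH.
Qed.

Lemma child_asym x y : child x y -> child y x -> False.
Proof.
move: x y; apply: (well_founded_ind child_wf) => x IH y xy yx.
exact: (IH y yx x yx xy).
Qed.

Definition node_rel (b : tree) (s : S) (x : 'I_(ar s) -> tree) : Prop :=
  if b is Node a W then
    exists t, [/\ W s t, exists i, t i = 0 & forall i, x i = push b a (t i)]
  else False.

Definition gen_rel (c : S -> Prop) (s : S) (x : 'I_(ar s) -> tree) : Prop :=
  injective x /\
  ((c s /\ forall i, exists k, x i = Leaf k) \/ exists i, node_rel (x i) x).

Definition gen (c : S -> Prop) : structure rel_sig :=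
  @Structure rel_sig tree (inhabits (Leaf 0))
    (fun f _ => of_void tree f) (gen_rel c).

Lemma gen_rel_Leaf c s (t : 'I_(ar s) -> nat) :
  gen_rel c (fun i => Leaf (t i)) <-> injective t /\ c s.
Proof.
split=> [[inj [[cs _]|[i []]]]|[inj cs]].
  by split=> // i j eqt; apply: inj; rewrite eqt.
split; first by move=> i j [/inj].
by left; split=> // i; exists (t i).
Qed.

(** The leaf clause fails, [b] being a node. No entry [a k] can contribute through its own list: [b]
    would then be [a k] or a child of it, while [a k] is a child of [b]. *)
Lemma gen_rel_Node c a W s (t : 'I_(ar s) -> nat) i0 :
  let x := push (Node a W) a in
  t i0 = 0 -> injective (x \o t) ->
  gen_rel c (x \o t) <-> exists t', W s t' /\ x \o t = x \o t'.
Proof.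
set b := Node a W => x ti0 inj.
have xb k : x k = b -> k = 0.
  by case: k => [//|k] /= Ek; case: (@child_asym b b); exists k.
split=> [[_ [[_ /(_ i0)]|[i]]]|[t' [Wt' Et]]].
- by rewrite /= ti0 => -[].
- rewrite [(_ \o _) i]/=; case Ei: (t i) => [|k].
    move=> [t' [Wt' _ Et]]; exists t'; split=> //.
    exact: functional_extensionality.
  rewrite /=; case Ea: (a k) => [//|a' W'] [t' [_ _ /(_ i0)]] /=.
  rewrite ti0 /=; case: (t' i0) => [|k'] Eb.
    by case: (@child_asym b b); exists k; rewrite Ea.
  have bak : child b (a k) by rewrite Ea /= -/b; exists k'.
  by case: (child_asym bak); exists k.
- split=> //; right; exists i0; rewrite [(_ \o _) i0]/= ti0 /=; exists t'.
  split=> [//||i]; last by have := congr1 (@^~ i) Et.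
  by exists i0; apply: xb; rewrite -[x _]/((x \o t') i0) -Et /= ti0.
Qed.

(** The partial isomorphisms of the back-and-forth, restricted to the symbols in [F] and the
    variables in [V]. *)
Definition sim (F : seq S) (V : seq nat) c c' (e e' : nat -> tree) : Prop :=
  {in V &, forall x y, e x = e y <-> e' x = e' y} /\
  {in F, forall s (t : 'I_(ar s) -> nat), (forall i, t i \in V) ->
     gen_rel c (e \o t) <-> gen_rel c' (e' \o t)}.

Lemma sim_sym F V c c' e e' : sim F V c c' e e' -> sim F V c' c e' e.
Proof.
by case=> eqV relF; split=> [x y xV yV|s sF t tV]; [rewrite eqV | rewrite relF].
Qed.

Lemma sim_sub F V F' V' c c' e e' :
  {subset F' <= F} -> {subset V' <= V} ->
  sim F V c c' e e' -> sim F' V' c c' e e'.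
Proof.
move=> sF sV [eqV relF]; split=> [x y /sV xV /sV yV|s /sF Fs t tV].
  exact: eqV.
by apply: relF => // i; apply: sV.
Qed.

(** A [d] already named by a variable is matched by the value of that variable under [e']; a new one
    by a fresh node over [e'] that copies its relations. *)
Lemma sim_push F V c c' e e' d :
  sim F [seq x.-1 | x <- V & 0 < x] c c' e e' ->
  exists d', sim F V c c' (push d e) (push d' e').
Proof.
set V' := map _ _ => -[eqV relF].
have V'P x : x.+1 \in V -> x \in V'.
  by move=> xV; apply/mapP; exists x.+1; rewrite ?mem_filter.
have [[x [xV Ed]]|newd] := classic (exists x, x.+1 \in V /\ d = e x).
  (* Reading index 0 as [x] turns the extended environments into [e] and [e'] composed with [p]. *)
  pose p k := if k is k'.+1 then k' else x.
  have pV k : k \in V -> p k \in V' by case: k => [_|k] /=; apply: V'P.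
  have pE (f : nat -> tree) : push (f x) f = f \o p.
    by apply: functional_extensionality; case.
  exists (e' x); rewrite Ed !pE; split=> [k l kV lV|s sF t tV].
    by apply: eqV; apply: pV.
  by apply: (relF s sF (p \o t)) => i; apply: pV.
pose W s (t : 'I_(ar s) -> nat) :=
  (forall i, t i \in V) /\ gen_rel c (push d e \o t).
pose b := Node e' W; exists b.
(* Each [e' k] is a child of [b], and no point is its own child. *)
have newb k : b <> e' k by move=> Eb; case: (@child_asym b b); exists k.
have eqV' : {in V &, forall x y,
    push d e x = push d e y <-> push b e' x = push b e' y}.
  move=> [|x] [|y] xV yV //=.
  - by split=> [Ed|/newb//]; case: newd; exists y.
  - by split=> [Ed|/esym/newb//]; case: newd; exists x.
  - by apply: eqV; apply: V'P.
split=> // s sF t tV.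
have injE : injective (push d e \o t) <-> injective (push b e' \o t).
  by split=> inj i j Eij; apply: inj; apply/eqV'.
have [[i0 ti0]|t_neq0] := classic (exists i, t i = 0).
  split=> [dt|bt].
    have inj : injective (push b e' \o t) by apply/injE; case: dt.
    by apply/(gen_rel_Node _ ti0 inj); exists t.
  have inj : injective (push b e' \o t) by case: bt.
  (* The listed tuple [t'] may differ from [t], but it has the same values over [b], hence over [d]
     by [eqV']. *)
  case/(gen_rel_Node _ ti0 inj): bt => t' [[t'V dt'] Et].
  suff -> : push d e \o t = push d e \o t' by [].
  apply: functional_extensionality => i; apply/eqV' => //.
  by have := congr1 (@^~ i) Et.
have tS i : t i = (t i).-1.+1.
  by case Ei: (t i) => //; case: t_neq0; exists i.
have pushE d' (f : nat -> tree) : push d' f \o t = f \o (predn \o t).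
  by apply: functional_extensionality => i; rewrite /= tS.
by rewrite !pushE; apply: relF => // i /=; apply: V'P; rewrite -tS.
Qed.

(** [sim_push], used in both directions, handles the quantifier. The colours may differ, because
    fresh nodes exist over any family whatever the colour. *)
Lemma sim_sat phi c c' (e e' : nat -> tree) :
  sim (syms phi) (fv phi) c c' e e' ->
  @sat _ (gen c) e phi <-> @sat _ (gen c') e' phi.
Proof.
elim: phi c c' e e' => [s t|s a|phi IH|phi IHphi psi IHpsi|phi IH] c c' e e'.
- by case=> + _; rewrite (termE s) (termE t) /=; apply; rewrite !inE eqxx ?orbT.
- rewrite (term_tupleE a) => -[_ relF] /=.
  apply: (relF s (mem_head _ _) (fun i => tvar (a i))) => i.
  by apply/(@mem_fv_Rel s (fun i => tvar (a i))); exists i.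
- by move=> h; rewrite /= (IH _ _ _ _ h).
- move=> h /=; rewrite (IHphi c c' e e') ?(IHpsi c c' e e') //.
    by apply: sim_sub h => x /=; rewrite mem_cat orbC => ->.
  by apply: sim_sub h => x /=; rewrite mem_cat => ->.
- move=> h; split=> -[d ed].
    by have [d' h'] := sim_push d h; exists d'; apply/(IH _ _ _ _ h').
  have [d' h'] := sim_push d (sim_sym h); exists d'.
  by apply/(IH _ _ _ _ h').
Qed.


(** * Quantifier elimination *)

Definition gen_theory : theory rel_sig :=
  theory_of (fun M => exists c, M = gen c).

Lemma model_gen c : model gen_theory (gen c).
Proof. by apply: model_theory_of; exists c. Qed.

Lemma T_equiv_gen phi psi :
  (forall c e, @sat _ (gen c) e phi <-> @sat _ (gen c) e psi) ->
  T_equiv gen_theory phi psi.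
Proof. by move=> eqv; apply: T_equiv_theory_of => _ [c ->] e. Qed.

(** A symbol is given by its position in [F], which keeps the index type finite when [S] is
    infinite. *)
Definition atom_index (N : nat) (F : seq S) : finType :=
  ('I_N * 'I_N +
   {j : 'I_(size F) & {ffun 'I_(ar (tnth (in_tuple F) j)) -> 'I_N}})%type.

Definition atom N F (i : atom_index N F) : formula rel_sig :=
  match i with
  | inl (x, y) => Eq (Var x) (Var y)
  | inr (existT j t) =>
      @Rel rel_sig (tnth (in_tuple F) j) (fun i => Var (t i))
  end.

Lemma sim_atom N F c c' (e e' : nat -> tree) :
  {in enum (atom_index N F), forall i,
    @sat _ (gen c) e (atom i) <-> @sat _ (gen c') e' (atom i)} ->
  sim F (iota 0 N) c c' e e'.
Proof.
move=> ag; split=> [x y|s /seq_tnthP[j ->] t tN].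
  rewrite !mem_iota => /= xN yN.
  by apply: (ag (inl (Ordinal xN, Ordinal yN))); rewrite mem_enum.
have ltN i : t i < N by have := tN i; rewrite mem_iota.
pose t' := [ffun i => Ordinal (ltN i)].
have tE (f : nat -> tree) : f \o t = fun i => f (t' i).
  by apply: functional_extensionality => i; rewrite ffunE.
by rewrite !tE; apply: (ag (inr (existT _ j t'))); rewrite mem_enum.
Qed.

(** By [sim_sat], [theta] is decided by the atoms in its own symbols and in finitely many
    variables. *)
Lemma quantifier_elimination theta :
  exists2 psi,
    bool_comb (fun chi => (exists x y, chi = Eq (Var x) (Var y)) \/
      exists s t, chi = @Rel rel_sig s (fun i => Var (t i))) psi
    & T_equiv gen_theory theta psi.
Proof.
pose N := (\max_(x <- fv theta) x).+1; pose F := syms theta.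
have [|psi bcpsi eqv] := @bool_comb_of_agreement _ (fun M => exists c, M = gen c)
    _ (@atom N F) (enum (atom_index N F)) (fun M e => sat e theta).
  move=> M M' e e' [c EM] [c' EM']; subst M M' => /sim_atom h.
  suff /sim_sat E : sim F (fv theta) c c' e e' by move/E.
  apply: sim_sub h => // x xth.
  by have := @leq_bigmax_seq _ _ predT id x xth isT; rewrite mem_iota.
exists psi; last exact: T_equiv_theory_of.
apply: bool_comb_mono bcpsi => chi [->|[[[x y]|[j t]] ->]].
- by left; exists 0, 0.
- by left; exists x, y.
- by right; exists (tnth (in_tuple F) j), (fun i => nat_of_ord (t i)).
Qed.

(** * Colours and lower bounds for witnesses *)

Lemma sat_Leaf_color c c' phi (rho : nat -> nat) :
  {in fv phi &, injective rho} ->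
  (forall s, ar s <= size (undup (fv phi)) -> c s <-> c' s) ->
  @sat _ (gen c) (@Leaf) phi <-> @sat _ (gen c') (@Leaf \o rho) phi.
Proof.
move=> injr cc'; apply: sim_sat; split=> [x y xV yV|s _ t tV].
  by split=> [[->]|/= [/(injr _ _ xV yV) ->]].
rewrite (gen_rel_Leaf c t) (gen_rel_Leaf c' (rho \o t)).
have injE : injective t <-> injective (rho \o t).
  split=> inj i j => [/= /injr|] Eij; apply: inj; last by rewrite /= Eij.
  exact: Eij.
rewrite -injE; have [inj|Ninj] := classic (injective t); last by split=> -[].
(* An injective tuple of free variables of [phi] is no longer than their number, so [cc'] covers the
   colour of [s]. *)
rewrite cc' // -[X in X <= _](card_ord (ar s)) -(size_image t).
apply: uniq_leq_size => [|_ /imageP[i _ ->]]; last by rewrite mem_undup.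
by rewrite map_inj_uniq ?enum_uniq.
Qed.

Lemma sat_ident_Rel c s :
  @sat _ (gen c) (@Leaf) (@Rel rel_sig s (fun i => Var i)) <-> c s.
Proof.
by rewrite /= (gen_rel_Leaf c (fun i : 'I_(ar s) => i)); split=> [[]|] //;
  split=> //; apply: val_inj.
Qed.

(** The atom of [s] at distinct leaves reads off the colour of [s]. In its decomposition, [k]-ary
    parts see only colours of arity at most [k], and an instance has the value of its witness, the
    renaming being injective. *)
Lemma witnesses_color k m (phi : 'I_m -> formula rel_sig) c c' :
  witnesses gen_theory k phi ->
  (forall s, ar s <= k -> c s <-> c' s) ->
  (forall i, @sat _ (gen c) (@Leaf) (phi i) <-> @sat _ (gen c') (@Leaf) (phi i)) ->
  forall s, c s <-> c' s.
Proof.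
move=> wit cc' agphi s; rewrite -2!sat_ident_Rel.
have [psi [bcpsi eqv]] := wit (@Rel rel_sig s (fun i => Var i)).
rewrite (eqv _ (@model_gen c)) (eqv _ (@model_gen c')) {eqv}.
elim: bcpsi => {psi} [psi|psi _ IH|psi psi' _ IH _ IH'] /=; last 2 first.
- by rewrite IH.
- by rewrite IH IH'.
case=> [[chi [bcchi eqv]]|[i [rho [injr ->]]]].
  rewrite (eqv _ (@model_gen c)) (eqv _ (@model_gen c')) {eqv}.
  elim: bcchi => {chi} [chi sz|chi _ IH|chi chi' _ IH _ IH'] /=.
  - apply: (@sat_Leaf_color _ _ _ id) => // s' s'chi.
    exact/cc'/(leq_trans s'chi).
  - by rewrite IH.
  - by rewrite IH IH'.
by rewrite !sat_ren -(@sat_Leaf_color c c) // -(@sat_Leaf_color c' c') //.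
Qed.

Lemma witnesses_size k m p (phi : 'I_m -> formula rel_sig) (sg : 'I_p -> S) :
  witnesses gen_theory k phi -> injective sg -> (forall j, k < ar (sg j)) ->
  p <= m.
Proof.
move=> wit injsg gtk.
(* Symbols outside the image of [sg] get the empty colour, so any two of these colours agree up to
   arity [k]. *)
pose col (f : {ffun 'I_p -> bool}) s := exists2 j, s = sg j & f j.
pose values (f : {ffun 'I_p -> bool}) : {ffun 'I_m -> bool} :=
  [ffun i => if excluded_middle_informative
                  (@sat _ (gen (col f)) (@Leaf) (phi i)) then true else false].
have colE f j : col f (sg j) <-> f j.
  by split=> [[j' /injsg ->]|fj] //; exists j.
suff inj : injective values.
  by have := leq_card _ inj; rewrite !card_ffun !card_ord card_bool leq_exp2l.
move=> f f' Eff'.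
have col_small g s : ar s <= k -> ~ col g s.
  by move=> sk [j Es _]; have := gtk j; rewrite -Es ltnNge sk.
have eqcol : forall s, col f s <-> col f' s.
  apply: (witnesses_color wit) => [s sk|i].
    by split=> /col_small; case.
  have /ffunP/(_ i) := Eff'; rewrite !ffunE.
  by do 2!case: excluded_middle_informative.
by apply/ffunP => j; apply/idP/idP => fj; apply/colE; apply/eqcol; apply/colE.
Qed.

Lemma witnesses_length k m l (phi : 'I_m -> formula rel_sig) (x : seq nat) s :
  witnesses gen_theory k phi -> (forall i, {subset fv (phi i) <= x}) ->
  size x = l -> k < ar s -> ar s <= l.
Proof.
move=> wit sub <- gtk; rewrite leqNgt; apply/negP => ltx.
(* The empty colour is compared with the colour of [s] alone; witnesses in fewer than [ar s]
   variables cannot separate them. *)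
suff /(_ s) : forall s', False <-> s' = s by case=> _ /(_ erefl).
apply: (witnesses_color wit (c := fun=> False) (c' := eq^~ s)) => [s' s'k|i].
  by split=> // Es; rewrite Es leqNgt gtk in s'k.
apply: (@sat_Leaf_color _ _ _ id) => // s' s'i.
split=> // Es; move: s'i; rewrite Es leqNgt (leq_ltn_trans _ ltx) //.
apply: uniq_leq_size (undup_uniq _) _ => y; rewrite mem_undup.
exact: sub.
Qed.

End Generic.

(** * The theory attaining a given degree *)

Definition two_arity n r m (s : nat + 'I_m) : nat :=
  if s is inl _ then n else r.

Arguments two_arity : clear implicits.

Definition extra_rel n r m (j : 'I_m) : formula (rel_sig (two_arity n r m)) :=
  @Rel (rel_sig (two_arity n r m)) (inr j) (fun i => Var i).

Lemma size_undup_fv_Rel (S : eqType) (ar : S -> nat) s (t : 'I_(ar s) -> nat) :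
  size (undup (fv (@Rel (rel_sig ar) s (fun i => Var (t i))))) <= ar s.
Proof.
rewrite -[X in _ <= X](card_ord (ar s)) -(size_image t).
apply: uniq_leq_size (undup_uniq _) _ => x; rewrite mem_undup.
by case/mem_fv_Rel => i ->; apply: image_f.
Qed.

Lemma nary_base (L : signature) (T : theory L) n phi :
  size (undup (fv phi)) <= n -> nary T n phi.
Proof. by move=> sz; exists phi; split; [apply: bc_base|]. Qed.

Lemma extra_rel_instance n r m (j : 'I_m) (t : 'I_r -> nat) :
  injective t ->
  instance (extra_rel n r j)
    (@Rel (rel_sig (two_arity n r m)) (inr j) (fun i => Var (t i))).
Proof.
(* The default 0 is taken only at indices from [r] on, which are not free in [extra_rel]. *)
move=> inj; pose rho x := if insub x is Some i then t i else 0.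
have rhoE i : rho (val i) = t i by rewrite /rho valK.
exists rho; split=> [x y|].
  move=> /(@mem_fv_Rel _ _ (inr j))[i ->] /(@mem_fv_Rel _ _ (inr j))[i' ->].
  by rewrite !rhoE => /inj ->.
rewrite /=; congr Rel; apply: functional_extensionality => i.
by rewrite rhoE.
Qed.

Lemma witnesses_extra_rel n r m : 2 <= n ->
  witnesses (gen_theory (two_arity n r m)) n (@extra_rel n r m).
Proof.
move=> n_ge2 theta; have [psi bcpsi eqv] := quantifier_elimination theta.
exists psi; split=> //; apply: bool_comb_mono bcpsi => chi.
case=> [[x [y ->]]|[[q|j] [t ->]]].
(* Equalities have up to two free variables, whence [2 <= n]. *)
- left; apply: nary_base; apply: leq_trans n_ge2.
  exact: (@leq_trans (size [:: x; y])) (size_undup _) _.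
- by left; apply: nary_base; apply: size_undup_fv_Rel.
have [inj|Ninj] := classic (injective t).
  by right; exists j; apply: extra_rel_instance.
(* At a tuple with a repeated variable the relation is identically false. *)
left; exists (Not (Eq (Var 0) (Var 0))); split.
  by apply: bc_not; apply: bc_base; apply: leq_trans n_ge2.
apply: T_equiv_gen => c e /=; split=> [[inj _]|[] //]; case: Ninj => i i' Eii'.
by apply: inj; rewrite Eii'.
Qed.

Theorem theorem2p2 (n m r : nat) (hn : 2 <= n) (hmr : admissible n m r) :
  exists (L : signature) (T : theory L), is_aar T n /\ is_deg_aar T m r.
Proof.
pose T := gen_theory (two_arity n r m).
have wit : witnesses T n (@extra_rel n r m) by apply: witnesses_extra_rel.
have r_gt (j : 'I_m) : n < r.
  by case: hmr => [[m0 _]|[_ //]]; case: j => j; rewrite m0.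
have aarT : is_aar T n.
  split; [exact: ltnW | by exists m, (@extra_rel n r m) |].
  move=> k _ [m' [phi witk]]; rewrite leqNgt; apply/negP => kn.
  (* One more [n]-ary symbol than there are witnesses, each of arity above [k]. *)
  pose sg (j : 'I_m'.+1) : nat + 'I_m := inl (val j).
  suff : m'.+1 <= m' by rewrite ltnn.
  by apply: (witnesses_size (sg := sg) witk) => // i j [/val_inj].
exists (rel_sig (two_arity n r m)), T; split=> //; exists n; split=> //.
- exists (iota_tuple r 0), (@extra_rel n r m); split=> // [|j x].
    exact: iota_uniq.
  by case/(@mem_fv_Rel _ _ (inr j)) => i ->; rewrite mem_iota /= ltn_ord.
- move=> m' l' [x [phi [_ _ wit']]].
  by apply: (witnesses_size (sg := inr) wit') => // i j [].
- move=> l' [x [phi [_ sub wit']]].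
  case: hmr => [[_ -> //]|[m_gt0 nr]].
  exact: (witnesses_length (s := inr (Ordinal m_gt0)) wit' sub (size_tuple x)).
Qed.
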